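(* Let $(A,\dashv_A,\vdash_A)$ and $(A^*,\dashv_{A^*},\vdash_{A^*})$ be diassociative algebras, where $A^*$ is the dual space of $A$. Let $\Delta_{\dashv_A},\Delta_{\vdash_A}:A\to A\otimes A$ be the linear duals of $\dashv_{A^*}$ and $\vdash_{A^*}$, respectively. Then $$(A,A^*,-R^*_{\bullet_A},L^*_{\vdash_A},R^*_{\dashv_A},L^*_{\bullet_A},-R^*_{\bullet_{A^*}},L^*_{\vdash_{A^*}},R^*_{\dashv_{A^*}},L^*_{\bullet_{A^*}})$$ is a matched pair of diassociative algebras if and only if $(A,\dashv_A,\vdash_A,\Delta_{\dashv_A},\Delta_{\vdash_A})$ is a diassociative bialgebra.
   Context: All vector spaces are finite-dimensional over a field $\mathbf{k}$ of characteristic $0$. A diassociative algebra is a triple $(A,\dashv_A,\vdash_A)$ consisting of a vector space $A$ and two bilinear operations such that for all $x,y,z\in A$ (subscripts omitted): $(x\dashv y)\dashv z=x\dashv(y\dashv z)=x\dashv(y\vdash z)$; $(x\vdash y)\dashv z=x\vdash(y\dashv z)$; $(x\vdash y)\vdash z=(x\dashv y)\vdash z=x\vdash(y\vdash z)$. Put $x\bullet_A y:=x\vdash_A y-x\dashv_A y$, and similarly $\bullet_{A^*}$. For a bilinear operation $\diamond$, $L_\diamond(x)y=x\diamond y$ and $R_\diamond(y)x=x\diamond y$. For a linear map $\rho:A\to\mathrm{End}(V)$, $\rho^*:A\to\mathrm{End}(V^* )$ is the transpose: $\langle\rho^*(x)u^*,v\rangle=\langle u^*,\rho(x)v\rangle$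 (no sign). For operations on $A^*$, $(A^* )^*$ is identified with $A$. The linear dual of an operation $*$ on $A^*$ is $\Delta:A\to A\otimes A$ with $\langle\Delta(x),a^*\otimes b^*\rangle=\langle x,a^* * b^*\rangle$. $\sigma(u\otimes v)=v\otimes u$. Matched pair: let $(A,\dashv_A,\vdash_A)$, $(B,\dashv_B,\vdash_B)$ be diassociative algebras and let $\ell_{\dashv_A},r_{\dashv_A},\ell_{\vdash_A},r_{\vdash_A}:A\to\mathrm{End}(B)$, $\ell_{\dashv_B},r_{\dashv_B},\ell_{\vdash_B},r_{\vdash_B}:B\to\mathrm{End}(A)$ be linear maps. The tuple $(A,B,\ell_{\dashv_A},r_{\dashv_A},\ell_{\vdash_A},r_{\vdash_A},\ell_{\dashv_B},r_{\dashv_B},\ell_{\vdash_B},r_{\vdash_B})$ is a matched pair of diassociative algebras if $A\oplus B$ is a diassociative algebra under the operations, for $*\in\{\dashv,\vdash\}$, $x,y\in A$, $a,b\in B$, $$(x+a)*_{A\bowtie B}(y+b)=\big(x*_A y+r_{*_B}(b)x+\ell_{*_B}(a)y\big)+\big(a*_B b+\ell_{*_A}(x)b+r_{*_A}(y)a\big).$$ A diassociative coalgebra is a triple $(A,\Delta_{\dashv},\Delta_{\vdash})$ with linear maps $\Delta_{\dashv},\Delta_{\vdash}:A\to A\otimes A$ such that $(\mathrm{id}\otimes\Delta_{\dashv})\Delta_{\dashv}=(\mathrm{id}\otimes\Delta_{\vdash})\Delta_{\dashv}=(\Delta_{\dashv}\otimes\mathrm{id})\Delta_{\dashv}$; $(\Delta_{\vdash}\otimes\mathrm{id})\Delta_{\dashv}=(\mathrm{id}\otimes\Delta_{\dashv})\Delta_{\vdash}$;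 $(\Delta_{\dashv}\otimes\mathrm{id})\Delta_{\vdash}=(\Delta_{\vdash}\otimes\mathrm{id})\Delta_{\vdash}=(\mathrm{id}\otimes\Delta_{\vdash})\Delta_{\vdash}$. A diassociative bialgebra is $(A,\dashv,\vdash,\Delta_{\dashv},\Delta_{\vdash})$ such that $(A,\dashv,\vdash)$ is a diassociative algebra, $(A,\Delta_{\dashv},\Delta_{\vdash})$ is a diassociative coalgebra and, with $\Delta_{\bullet}:=\Delta_{\vdash}-\Delta_{\dashv}$, for all $x,y\in A$: (1) $\Delta_{\vdash}(x\dashv y)=(\mathrm{id}\otimes L_{\dashv}(x))\Delta_{\vdash}(y)-(R_{\bullet}(y)\otimes\mathrm{id})\Delta_{\vdash}(x)=(\mathrm{id}\otimes L_{\dashv}(x))\Delta_{\bullet}(y)+(R_{\dashv}(y)\otimes\mathrm{id})\Delta_{\vdash}(x)$; (2) $\sigma((L_{\vdash}(y)\otimes\mathrm{id})\Delta_{\vdash}(x))-(L_{\dashv}(x)\otimes\mathrm{id})\Delta_{\bullet}(y)=(L_{\dashv}(x)\otimes\mathrm{id})\Delta_{\dashv}(y)+\sigma((L_{\bullet}(y)\otimes\mathrm{id})\Delta_{\vdash}(x))=\sigma((\mathrm{id}\otimes R_{\dashv}(y))\Delta_{\vdash}(x))+(\mathrm{id}\otimes R_{\bullet}(x))\Delta_{\bullet}(y)$; (3) $\sigma((\mathrm{id}\otimes R_{\vdash}(y))\Delta_{\vdash}(x))-(\mathrm{id}\otimes R_{\bullet}(x))\Delta_{\dashv}(y)=(\mathrm{id}\otimes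 R_{\dashv}(x))\Delta_{\dashv}(y)+\sigma((\mathrm{id}\otimes R_{\vdash}(y))\Delta_{\bullet}(x))=(L_{\vdash}(x)\otimes\mathrm{id})\Delta_{\dashv}(y)+\sigma((L_{\bullet}(y)\otimes\mathrm{id})\Delta_{\bullet}(x))$; (4) $\Delta_{\dashv}(x\vdash y)=(\mathrm{id}\otimes L_{\vdash}(x))\Delta_{\dashv}(y)-(R_{\vdash}(y)\otimes\mathrm{id})\Delta_{\bullet}(x)=(\mathrm{id}\otimes L_{\bullet}(x))\Delta_{\dashv}(y)+(R_{\vdash}(y)\otimes\mathrm{id})\Delta_{\dashv}(x)$; (5) $\Delta_{\dashv}(x\dashv y)=(R_{\dashv}(y)\otimes\mathrm{id})\Delta_{\dashv}(x)-(\mathrm{id}\otimes L_{\bullet}(x))\Delta_{\bullet}(y)$; (6) $\Delta_{\vdash}(x\vdash y)=(\mathrm{id}\otimes L_{\vdash}(x))\Delta_{\vdash}(y)-(R_{\bullet}(y)\otimes\mathrm{id})\Delta_{\bullet}(x)$. *)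

(* Defs.v *)
From HB Require Import structures.
From mathcomp Require Import all_boot all_order all_algebra.

Set Implicit Arguments.
Unset Strict Implicit.
Unset Printing Implicit Defensive.

Import GRing.Theory.

Local Open Scope ring_scope.

Definition dual (k : fieldType) (V : vectType k) : vectType k := 'Hom(V, k^o).

(* Bilinear maps U x V -> W are represented in curried form, as elements of
   'Hom(U, 'Hom(V, W)); in particular a bilinear operation on A is an element
   of 'Hom(A, 'End(A)). *)
Section Bilinear.

Variables (k : fieldType) (U V W : vectType k).

(* [linfun] returns a junk value on non-linear functions, so [bilin f] is
   meaningful only for bilinear f; see [bilinE]. *)
Definition bilin (f : U -> V -> W) : 'Hom(U, 'Hom(V, W)) :=
  linfun (fun u => linfun (f u)).

Lemma bilinE f : bilinear_for *:%R *:%R f -> forall u v, bilin f u v = f u v.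
Proof.
move=> [fl fr] u v.
pose F u := HB.pack_for {linear V -> W} (f u)
  (GRing.isLinear.Build _ _ _ _ _ (fr u)).
have FE w x : linfun (f w) x = f w x by exact: (lfunE (F w)).
have linF : linear (fun u => linfun (f u)).
  by move=> a x y; apply/lfunP => z; rewrite !lfun_simp !FE (fl z).
pose G := HB.pack_for {linear U -> 'Hom(V, W)} (fun u => linfun (f u))
  (GRing.isLinear.Build _ _ _ _ _ linF).
by rewrite /bilin (lfunE G u) FE.
Qed.

End Bilinear.

Definition flip (k : fieldType) (U V W : vectType k)
    (b : 'Hom(U, 'Hom(V, W))) : 'Hom(V, 'Hom(U, W)) :=
  bilin (fun v u => b u v).

Lemma flipE (k : fieldType) (U V W : vectType k) (b : 'Hom(U, 'Hom(V, W)))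
  (u : U) (v : V) : flip b v u = b u v.
Proof.
by rewrite /flip bilinE //; split=> x c y z; rewrite linearP ?lfun_simp.
Qed.

Section Tensor.

Variable k : fieldType.
Implicit Types U V W : vectType k.

(* U (x) V is modelled by coordinate matrices in the bases chosen by the
   library; [pure_bilinear], [tliftE] and [tensor_hom_eq] are its universal
   property. *)
Definition tensor U V : vectType k := 'M[k]_(\dim {:U}, \dim {:V}).

Definition pure U V (u : U) (v : V) : tensor U V :=
  \matrix_(i, j) (coord (vbasis {:U}) i u * coord (vbasis {:V}) j v).

Definition tlift U V W (b : 'Hom(U, 'Hom(V, W))) : 'Hom(tensor U V, W) :=
  linfun (fun t : 'M[k]_(\dim {:U}, \dim {:V}) =>
    \sum_i \sum_j t i j *: b (vbasis {:U})`_i (vbasis {:V})`_j).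

Lemma pure_bilinear U V : bilinear_for *:%R *:%R (@pure U V).
Proof.
split=> [v c x y | u c x y]; apply/matrixP => i j; rewrite !mxE linearP /=.
  by rewrite mulrDl mulrA.
by rewrite mulrDr mulrCA.
Qed.

Lemma tlift_matE U V W (b : 'Hom(U, 'Hom(V, W)))
    (t : 'M[k]_(\dim {:U}, \dim {:V})) :
  tlift b t = \sum_i \sum_j t i j *: b (vbasis {:U})`_i (vbasis {:V})`_j.
Proof.
pose F (t : 'M[k]_(\dim {:U}, \dim {:V})) :=
  \sum_i \sum_j t i j *: b (vbasis {:U})`_i (vbasis {:V})`_j.
have linF : linear F.
  move=> c x y; rewrite /F scaler_sumr -big_split; apply: eq_bigr => i _.
  rewrite scaler_sumr -big_split; apply: eq_bigr => j _ /=.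
  by rewrite !mxE scalerDl scalerA.
pose G := HB.pack_for {linear 'M[k]_(\dim {:U}, \dim {:V}) -> W} F
  (GRing.isLinear.Build _ _ _ _ _ linF).
exact: (lfunE G t).
Qed.

Lemma tliftE U V W (b : 'Hom(U, 'Hom(V, W))) u v : tlift b (pure u v) = b u v.
Proof.
rewrite tlift_matE.
rewrite [in RHS](coord_vbasis (memvf u)) linear_sum sum_lfunE.
apply: eq_bigr => i _.
rewrite [in RHS](coord_vbasis (memvf v)) linear_sum; apply: eq_bigr => j _.
by rewrite mxE !linearZ /= scale_lfunE scalerA mulrC.
Qed.

Lemma tensor_hom_eq U V W (f g : 'Hom(tensor U V, W)) :
  (forall u v, f (pure u v) = g (pure u v)) -> f = g.
Proof.
move=> fg; apply/lfunP => t.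
suff -> : t = \sum_i \sum_j (t : 'M_(_, _)) i j *:
    pure (vbasis {:U})`_i (vbasis {:V})`_j.
  rewrite !linear_sum; apply: eq_bigr => i _.
  by rewrite !linear_sum; apply: eq_bigr => j _; rewrite !linearZ /= fg.
rewrite [LHS](matrix_sum_delta t); apply: eq_bigr => i _.
apply: eq_bigr => j _; congr (_ *: _); apply/matrixP => x y.
rewrite !mxE !coord_free ?(basis_free (vbasisP _)) //.
by rewrite -natrM mulnb ![_ == i]eq_sym ![_ == j]eq_sym.
Qed.

Definition tmap U V U' V' (f : 'Hom(U, U')) (g : 'Hom(V, V')) :
    'Hom(tensor U V, tensor U' V') :=
  tlift (bilin (fun u v => pure (f u) (g v))).

Definition tswap U V : 'Hom(tensor U V, tensor V U) :=
  tlift (bilin (fun u v => pure v u)).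

Definition tassoc U V W :
    'Hom(tensor (tensor U V) W, tensor U (tensor V W)) :=
  tlift (bilin (fun t w => tlift (bilin (fun u v => pure u (pure v w))) t)).

Definition tpair U V (a : dual U) (b : dual V) : dual (tensor U V) :=
  tlift (bilin (fun u v => a u * b v : k^o)).

Lemma tmapE U V U' V' (f : 'Hom(U, U')) (g : 'Hom(V, V')) u v :
  tmap f g (pure u v) = pure (f u) (g v).
Proof.
have [pl pr] := pure_bilinear U' V'.
by rewrite /tmap tliftE bilinE //; split=> x c y z /=;
  rewrite linearP ?pl ?pr.
Qed.

Lemma tswapE U V (u : U) (v : V) : tswap U V (pure u v) = pure v u.
Proof.
have [pl pr] := pure_bilinear V U.
by rewrite /tswap tliftE bilinE //; split=> x c y z; rewrite ?pl ?pr.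
Qed.

Lemma tassocE U V W (u : U) (v : V) (w : W) :
  tassoc U V W (pure (pure u v) w) = pure u (pure v w).
Proof.
have [pl pr] := pure_bilinear U (tensor V W).
have [ql qr] := pure_bilinear V W.
have inner (w' : W) : bilinear_for *:%R *:%R
      (fun (u' : U) (v' : V) => pure u' (pure v' w')).
  by split=> x c y z /=; [rewrite pl | rewrite ql pr].
rewrite /tassoc tliftE bilinE; first by rewrite tliftE bilinE.
split=> [x c y z | t c y z]; first by rewrite linearP.
set f := tlift _; set g := tlift _; set h := tlift _.
suff -> : f = c *: g + h by rewrite !lfun_simp.
apply: tensor_hom_eq => u' v'; rewrite !lfun_simp /f /g /h !tliftE.
by rewrite !bilinE // qr pr.
Qed.

Lemma tpairE U V (a : dual U) (b : dual V) u v :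
  tpair a b (pure u v) = a u * b v.
Proof.
rewrite /tpair tliftE bilinE //; split=> x c y z; rewrite linearP /=.
  by rewrite mulrDl -scalerAl.
by rewrite mulrDr -scalerAr.
Qed.

End Tensor.

Arguments tswap {k U V}.
Arguments tassoc {k U V W}.

Notation "f \ox g" := (tmap f g) (at level 40, left associativity) : ring_scope.

Section Duality.

Variable k : fieldType.
Implicit Types A B V : vectType k.

Definition transp A V (rho : 'Hom(A, 'End(V))) : 'Hom(A, 'End(dual V)) :=
  bilin (fun x u => (u \o rho x)%VF).

Lemma transpE A V (rho : 'Hom(A, 'End(V))) x u v :
  transp rho x u v = u (rho x v).
Proof.
rewrite /transp bilinE ?lfun_simp //.
split=> w c y z; apply/lfunP => t; rewrite !lfun_simp //.
by rewrite linearP !lfun_simp linearP.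
Qed.

Definition bidual A : 'Hom(A, dual (dual A)) :=
  bilin (fun (x : A) (a : dual A) => a x : k^o).

Lemma bidualE A (x : A) (a : dual A) : bidual A x a = a x.
Proof.
by rewrite /bidual bilinE //; split=> y c z t; rewrite ?linearP ?lfun_simp.
Qed.

(* Transport along the canonical identification of A with its bidual. *)
Definition unbidual A B (theta : 'Hom(B, 'End(dual (dual A)))) :
    'Hom(B, 'End(A)) :=
  bilin (fun b x => (bidual A)^-1%VF (theta b (bidual A x))).

Lemma bidualK A : cancel (bidual A)^-1%VF (bidual A).
Proof.
move=> phi; apply: limg_lfunVK.
pose e := vbasis {:A}.
pose c (i : 'I_(\dim {:A})) : dual A := linfun (coord e i : A -> k^o).
have cE i x : c i x = coord e i x by rewrite lfunE.
suff -> : phi = bidual A (\sum_(i < \dim {:A}) (phi (c i) : k) *: e`_i).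
  exact: memv_img (memvf _).
apply/lfunP => a; rewrite bidualE linear_sum.
have {1}-> : a = \sum_(i < \dim {:A}) (a e`_i : k) *: c i.
  apply/lfunP => x; rewrite {1}(coord_vbasis (memvf x)) linear_sum sum_lfunE.
  by apply: eq_bigr => i _; rewrite linearZ scale_lfunE cE; apply: mulrC.
rewrite linear_sum; apply: eq_bigr => i _; rewrite !linearZ.
exact: mulrC.
Qed.

Lemma unbidualE A B (rho : 'Hom(B, 'End(dual A))) b x (a : dual A) :
  a (unbidual (transp rho) b x) = rho b a x.
Proof.
rewrite /unbidual bilinE; last first.
  by split=> y c z t; rewrite !(linearP, lfun_simp).
by rewrite -bidualE bidualK transpE bidualE.
Qed.

Definition linear_dual A (op : 'Hom(dual A, 'End(dual A)))
    (D : 'Hom(A, tensor A A)) : Prop :=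
  forall x a b, tpair a b (D x) = op a b x.

Lemma tensor_pair_eq U V (s t : tensor U V) :
  (forall (a : dual U) (b : dual V), tpair a b s = tpair a b t) -> s = t.
Proof.
move=> st; apply/matrixP => i j.
pose ci : dual U := linfun (coord (vbasis {:U}) i : U -> k^o).
pose cj : dual V := linfun (coord (vbasis {:V}) j : V -> k^o).
have E r : tpair ci cj r = (r : 'M_(_, _)) i j.
  pose g : dual (tensor U V) :=
    linfun (fun r : 'M[k]_(\dim {:U}, \dim {:V}) => r i j : k^o).
  have gE r' : g r' = (r' : 'M_(_, _)) i j.
    pose h (r : 'M[k]_(\dim {:U}, \dim {:V})) : k^o := r i j.
    have linh : linear h by move=> c x y; rewrite /h !mxE.
    pose H := HB.pack_for {linear 'M[k]_(\dim {:U}, \dim {:V}) -> k^o} h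
      (GRing.isLinear.Build _ _ _ _ _ linh).
    exact: (lfunE H r').
  rewrite -gE; congr (fun_of_lfun _ _); apply: tensor_hom_eq => u v.
  by rewrite tpairE gE mxE !lfunE.
by rewrite -!E st.
Qed.

Lemma linear_dual_unique A op (D D' : 'Hom(A, tensor A A)) :
  linear_dual op D -> linear_dual op D' -> D = D'.
Proof.
move=> DE D'E; apply/lfunP => x; apply: tensor_pair_eq => a b.
by rewrite DE D'E.
Qed.

Lemma linear_dual_exists A (op : 'Hom(dual A, 'End(dual A))) :
  exists D : 'Hom(A, tensor A A), linear_dual op D.
Proof.
pose e := vbasis {:A}.
pose c (i : 'I_(\dim {:A})) : dual A := linfun (coord e i : A -> k^o).
pose F (x : A) : tensor A A :=
  \sum_i \sum_j (op (c i) (c j) x : k) *: pure e`_i e`_j.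
have linF : linear F.
  move=> t x y; rewrite /F scaler_sumr -big_split; apply: eq_bigr => i _.
  rewrite scaler_sumr -big_split; apply: eq_bigr => j _ /=.
  by rewrite linearP scalerDl scalerA.
pose G := HB.pack_for {linear A -> tensor A A} F
  (GRing.isLinear.Build _ _ _ _ _ linF).
have dualE (a : dual A) : a = \sum_(i < \dim {:A}) (a e`_i : k) *: c i.
  apply/lfunP => x; rewrite {1}(coord_vbasis (memvf x)) linear_sum sum_lfunE.
  apply: eq_bigr => i _; rewrite linearZ scale_lfunE lfunE.
  exact: mulrC.
exists (linfun F) => x a b; rewrite (lfunE G) /= /F.
rewrite linear_sum [in RHS](dualE a) linear_sum !sum_lfunE.
apply: eq_bigr => i _.
rewrite linear_sum [in RHS](dualE b) linear_sum sum_lfunE.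
apply: eq_bigr => j _; rewrite !linearZ /= !scale_lfunE tpairE.
set p := a _; set q := b _; set r := op _ _ _.
by change (r * (p * q) = q * (p * r) :> k); rewrite mulrC [p * q]mulrC -mulrA.
Qed.

End Duality.

Section Diassociative.

Variable k : fieldType.
Implicit Types A B V : vectType k.

(* The letters d and v stand for the operations dashv and vdash. *)
Record diassociative_algebra A (d v : 'Hom(A, 'End(A))) : Prop := {
  diass_dd : forall x y z,
    d (d x y) z = d x (d y z) /\ d x (d y z) = d x (v y z);
  diass_vd : forall x y z, d (v x y) z = v x (d y z);
  diass_vv : forall x y z,
    v (v x y) z = v (d x y) z /\ v (d x y) z = v x (v y z)
}.

Definition Lop A (op : 'Hom(A, 'End(A))) : 'Hom(A, 'End(A)) := op.
Definition Rop A (op : 'Hom(A, 'End(A))) : 'Hom(A, 'End(A)) := flip op.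

Definition bullet A (d v : 'Hom(A, 'End(A))) : 'Hom(A, 'End(A)) := v - d.

Definition bowtie A B (opA : 'Hom(A, 'End(A))) (opB : 'Hom(B, 'End(B)))
    (lA rA : 'Hom(A, 'End(B))) (lB rB : 'Hom(B, 'End(A))) :
    'Hom((A * B)%type, 'End((A * B)%type)) :=
  bilin (fun s t : A * B =>
    (opA s.1 t.1 + rB t.2 s.1 + lB s.2 t.1,
     opB s.2 t.2 + lA s.1 t.2 + rA t.1 s.2)).

Lemma bowtieE A B opA opB lA rA lB rB x a y b :
  @bowtie A B opA opB lA rA lB rB (x, a) (y, b) =
  (opA x y + rB b x + lB a y, opB a b + lA x b + rA y a).
Proof.
rewrite /bowtie bilinE //; split=> [t c s s' | s c t t'] /=;
  rewrite !linearP !lfun_simp; congr pair; rewrite /= !scalerDr.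
all: by rewrite [RHS]addrACA; congr (_ + _); exact: addrACA.
Qed.

Definition matched_pair A B
    (dA vA : 'Hom(A, 'End(A))) (dB vB : 'Hom(B, 'End(B)))
    (ldA rdA lvA rvA : 'Hom(A, 'End(B)))
    (ldB rdB lvB rvB : 'Hom(B, 'End(A))) : Prop :=
  [/\ diassociative_algebra dA vA, diassociative_algebra dB vB &
      diassociative_algebra (bowtie dA dB ldA rdA ldB rdB)
                            (bowtie vA vB lvA rvA lvB rvB)].

Record diassociative_coalgebra A (Dd Dv : 'Hom(A, tensor A A)) : Prop := {
  codiass_dd : ((\1 \ox Dd) \o Dd)%VF = ((\1 \ox Dv) \o Dd)%VF /\
               ((\1 \ox Dv) \o Dd)%VF = (tassoc \o (Dd \ox \1) \o Dd)%VF;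
  codiass_vd : (tassoc \o (Dv \ox \1) \o Dd)%VF = ((\1 \ox Dd) \o Dv)%VF;
  codiass_vv : (tassoc \o (Dd \ox \1) \o Dv)%VF =
               (tassoc \o (Dv \ox \1) \o Dv)%VF /\
               (tassoc \o (Dv \ox \1) \o Dv)%VF = ((\1 \ox Dv) \o Dv)%VF
}.

Record diassociative_bialgebra A (d v : 'Hom(A, 'End(A)))
    (Dd Dv : 'Hom(A, tensor A A)) : Prop := {
  bialg_algebra : diassociative_algebra d v;
  bialg_coalgebra : diassociative_coalgebra Dd Dv;
  bialg_1 : forall x y (b := bullet d v) (Db := Dv - Dd),
    Dv (d x y) = (\1 \ox Lop d x) (Dv y) - (Rop b y \ox \1) (Dv x) /\
    (\1 \ox Lop d x) (Dv y) - (Rop b y \ox \1) (Dv x) =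
    (\1 \ox Lop d x) (Db y) + (Rop d y \ox \1) (Dv x);
  bialg_2 : forall x y (b := bullet d v) (Db := Dv - Dd),
    tswap ((Lop v y \ox \1) (Dv x)) - (Lop d x \ox \1) (Db y) =
    (Lop d x \ox \1) (Dd y) + tswap ((Lop b y \ox \1) (Dv x)) /\
    (Lop d x \ox \1) (Dd y) + tswap ((Lop b y \ox \1) (Dv x)) =
    tswap ((\1 \ox Rop d y) (Dv x)) + (\1 \ox Rop b x) (Db y);
  bialg_3 : forall x y (b := bullet d v) (Db := Dv - Dd),
    tswap ((\1 \ox Rop v y) (Dv x)) - (\1 \ox Rop b x) (Dd y) =
    (\1 \ox Rop d x) (Dd y) + tswap ((\1 \ox Rop v y) (Db x)) /\
    (\1 \ox Rop d x) (Dd y) + tswap ((\1 \ox Rop v y) (Db x)) =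
    (Lop v x \ox \1) (Dd y) + tswap ((Lop b y \ox \1) (Db x));
  bialg_4 : forall x y (b := bullet d v) (Db := Dv - Dd),
    Dd (v x y) = (\1 \ox Lop v x) (Dd y) - (Rop v y \ox \1) (Db x) /\
    (\1 \ox Lop v x) (Dd y) - (Rop v y \ox \1) (Db x) =
    (\1 \ox Lop b x) (Dd y) + (Rop v y \ox \1) (Dd x);
  bialg_5 : forall x y (b := bullet d v) (Db := Dv - Dd),
    Dd (d x y) = (Rop d y \ox \1) (Dd x) - (\1 \ox Lop b x) (Db y);
  bialg_6 : forall x y (b := bullet d v) (Db := Dv - Dd),
    Dv (v x y) = (\1 \ox Lop v x) (Dv y) - (Rop b y \ox \1) (Db x)
}.

End Diassociative.

(* Main.v *)
Require Import Defs.
From HB Require Import structures.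
From mathcomp Require Import all_boot all_order all_algebra.
From mathcomp Require Import ring.

(* On M = A + A^* put the nondegenerate skew form w((x, a), (y, b)) =
   a(y) - b(x).  The actions of the statement are exactly those for which the
   product on M satisfies w(s -| t, u) = w(s, t |- u) and
   w(s |- t, u) = w(s, t |- u - t -| u).  Tested against w, the diassociativity
   axioms at (s, t, u; w) are then equivalent to the same axioms at the cyclic
   rotation (t, u, w; s).  Up to rotation, the homogeneous quadruples with at
   least three entries on the same side only involve the axioms of A or of A^*,
   and two mixed ones remain: (x, y, a, b), which gives the bialgebra identities
   (1), (4), (5), (6), and (x, a, y, b), which gives (2) and (3). *)

Import GRing.Theory.
Local Open Scope ring_scope.

Set Implicit Arguments.
Unset Strict Implicit.
Unset Printing Implicit Defensive.

(** Certificate rule for linear consequences: [a = b] is a signed sum of hypotheses, built with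
    [eq_add] and [esym], and [ring] checks that it has the same difference of sides as the goal. *)
Lemma eq_of_subr_eq (V : zmodType) (a b c e : V) :
  a = b -> c - e = a - b -> c = e.
Proof. by move=> -> /eqP; rewrite subrr subr_eq0 => /eqP. Qed.

Lemma eq_add (U : zmodType) (p q r s : U) : p = q -> r = s -> p + r = q + s.
Proof. by move=> -> ->. Qed.

(** * Cyclic rotation of the diassociativity axioms under an invariant skew form *)

Section Rotation.

Variables (k : fieldType) (M : vectType k).
Variables (d v : 'Hom(M, 'End(M))) (omega : M -> M -> k).

Definition diass_at (s t u w : M) : Prop :=
  [/\ omega (d (d s t) u) w = omega (d s (d t u)) w /\
      omega (d s (d t u)) w = omega (d s (v t u)) w,
      omega (d (v s t) u) w = omega (v s (d t u)) w &
      omega (v (v s t) u) w = omega (v (d s t) u) w /\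
      omega (v (d s t) u) w = omega (v s (v t u)) w].

Hypothesis omegaD : forall s, {morph omega s : t u / t + u}.

Lemma diass_atD s t u w w' :
  diass_at s t u w -> diass_at s t u w' -> diass_at s t u (w + w').
Proof.
rewrite /diass_at !omegaD.
by case=> -[-> ->] -> [-> ->]; case=> -[-> ->] -> [-> ->].
Qed.

Hypothesis omega_skew : forall s t, omega s t = - omega t s.
Hypothesis omega_d : forall s t u, omega (d s t) u = omega s (v t u).
Hypothesis omega_v : forall s t u,
  omega (v s t) u = omega s (v t u) - omega s (d t u).

(** Taking [s] out of every product by [omega_d] and [omega_v] leaves triple products of [t], [u],
    [w] paired with [s]. The chain of axioms for [d] turns into the chain for [v]; the remaining
    axioms turn into differences of axioms at the rotated quadruple. *)
Lemma diass_at_rot s t u w : diass_at t u w s -> diass_at s t u w.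
Proof.
rewrite /diass_at !(omega_skew _ s) => -[[/oppr_inj E1 /oppr_inj E2]].
move=> /oppr_inj E3 [/oppr_inj E4 /oppr_inj E5].
rewrite !(omega_d, omega_v) -?E5 -?E4 -?E3 -?E2 -?E1.
by split; [split| | split] => //; rewrite ?opprB ?addrA ?subrK.
Qed.

(** Invariance rewrites each triple product tested against [w] as pairings of two binary products:
    [s, t] against [u, w] when it is nested on the left, [t, u] against [w, s] when it is nested on
    the right. So eight scalars decide all five axioms, and they are parameters so that a caller can
    supply computed values. *)
Lemma diass_atE s t u w pdd pdv pvd pvv qdd qdv qvd qvv :
  omega (d s t) (d u w) = pdd -> omega (d s t) (v u w) = pdv ->
  omega (v s t) (d u w) = pvd -> omega (v s t) (v u w) = pvv ->
  omega (d t u) (d w s) = qdd -> omega (d t u) (v w s) = qdv ->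
  omega (v t u) (d w s) = qvd -> omega (v t u) (v w s) = qvv ->
  diass_at s t u w <->
  [/\ pdv = qdd - qdv /\ qdd - qdv = qvd - qvv, pvv = qdd &
      pvv - pvd = pdv - pdd /\ pdv - pdd = qvd].
Proof.
(* For right-nested products the outer factor [s] is moved cyclically to the far end, past [w]. *)
have dS r : omega (d s r) w = omega r (d w s) - omega r (v w s).
  by rewrite omega_d omega_skew omega_v opprB.
have vS r : omega (v s r) w = omega r (d w s).
  by rewrite omega_v !(omega_skew s) omega_v omega_d opprK opprB subrK.
move=> <- <- <- <- <- <- <- <-; rewrite /diass_at !dS !vS.
by rewrite !(omega_d (d s t), omega_d (v s t),
            omega_v (d s t), omega_v (v s t)).
Qed.

End Rotation.

(** * Pairing tensors with products of functionals *)

Section Pairing.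

Variable k : fieldType.
Implicit Types U V W : vectType k.

Lemma tpair_tmap U V U' V' (f : 'Hom(U, U')) (g : 'Hom(V, V'))
    (a : dual U') (b : dual V') t :
  tpair a b ((f \ox g) t) = tpair (a \o f)%VF (b \o g)%VF t.
Proof.
rewrite -[LHS]comp_lfunE; congr (fun_of_lfun _ _).
by apply: tensor_hom_eq => u v; rewrite comp_lfunE tmapE !tpairE !comp_lfunE.
Qed.

Lemma tpair_tswap U V (a : dual U) (b : dual V) t :
  tpair a b (tswap t) = tpair b a t.
Proof.
rewrite -[LHS]comp_lfunE; congr (fun_of_lfun _ _).
by apply: tensor_hom_eq => u v; rewrite comp_lfunE tswapE !tpairE mulrC.
Qed.

Lemma tpair_tassoc U V W (a : dual U) (b : dual V) (c : dual W) t :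
  tpair a (tpair b c) (tassoc t) = tpair (tpair a b) c t.
Proof.
pose F : 'Hom(tensor (tensor U V) W, k^o) := (tpair a (tpair b c) \o tassoc)%VF.
rewrite -[LHS]comp_lfunE -/F.
(* [tensor_hom_eq] decomposes one tensor product at a time. Fixing the last factor makes both sides
   linear in [tensor U V], so that it applies a second time. *)
pose contract (w : W) : 'Hom(tensor U V, tensor (tensor U V) W) :=
  flip (bilin (@pure k (tensor U V) W)) w.
have contractE w s : contract w s = pure s w.
  by rewrite /contract flipE bilinE //; apply: pure_bilinear.
congr (fun_of_lfun _ _); apply: tensor_hom_eq => s w.
rewrite tpairE -contractE -comp_lfunE.
pose G : 'Hom(tensor U V, k^o) := (c w : k) *: tpair a b.
transitivity (G s); last by rewrite /G scale_lfunE; apply: mulrC.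
congr (fun_of_lfun _ _); apply: tensor_hom_eq => u v.
rewrite !comp_lfunE contractE tassocE /G scale_lfunE !tpairE.
by rewrite mulrA mulrC.
Qed.

(** [tensor_pair_eq] on the outer product asks for every functional on [tensor V W], not only for
    those of the form [tpair b c]. Contracting the first factor with [a] leaves elements of
    [tensor V W], where pairs [b], [c] suffice. *)
Lemma tensor3_pair_eq U V W (s t : tensor U (tensor V W)) :
  (forall (a : dual U) (b : dual V) (c : dual W),
     tpair a (tpair b c) s = tpair a (tpair b c) t) -> s = t.
Proof.
move=> st; apply: tensor_pair_eq => a phi.
pose contract : 'Hom(tensor U (tensor V W), tensor V W) :=
  tlift (bilin (fun u x => (a u : k) *: x)).
have contractE psi r : tpair a psi r = psi (contract r).
  rewrite -[RHS]comp_lfunE; congr (fun_of_lfun _ _).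
  apply: tensor_hom_eq => u x.
  rewrite tpairE comp_lfunE tliftE bilinE ?linearZ //.
  split=> z c y y' /=; first by rewrite linearP scalerDl scalerA.
  by rewrite scalerDr !scalerA mulrC.
rewrite !contractE; congr (phi _).
by apply: tensor_pair_eq => b c; rewrite -!contractE st.
Qed.

End Pairing.

(** * Evaluation of functionals and the skew form on the sum of A and its dual *)

Section Evaluation.

Variables (k : fieldType) (A : vectType k).
Implicit Types (x y : A) (a b c f g : dual A) (op : 'Hom(dual A, 'End(dual A))).

(* The value is read in [k] instead of [k^o]. *)
Definition ev f x : k := f x.

Lemma evDl f g x : ev (f + g) x = ev f x + ev g x.
Proof. by rewrite /ev add_lfunE. Qed.

Lemma evNl f x : ev (- f) x = - ev f x.
Proof. by rewrite /ev opp_lfunE. Qed.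

Lemma evDr f x y : ev f (x + y) = ev f x + ev f y.
Proof. by rewrite /ev linearD. Qed.

Lemma evNr f x : ev f (- x) = - ev f x.
Proof. by rewrite /ev linearN. Qed.

Lemma ev_opBl op f g b x : ev (op (f - g) b) x = ev (op f b) x - ev (op g b) x.
Proof. by rewrite linearB /= !lfun_simp -evNl -evDl. Qed.

Lemma ev_opBr op f g b x : ev (op b (f - g)) x = ev (op b f) x - ev (op b g) x.
Proof. by rewrite linearB /= -evNl -evDl. Qed.

Lemma ev_opNl op f b x : ev (op (- f) b) x = - ev (op f b) x.
Proof. by rewrite linearN /= opp_lfunE evNl. Qed.

Lemma ev_opNr op f b x : ev (op b (- f)) x = - ev (op b f) x.
Proof. by rewrite linearN /= evNl. Qed.

Lemma ev_bullet op op' a b x :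
  ev (bullet op op' a b) x = ev (op' a b) x - ev (op a b) x.
Proof. by rewrite /bullet !lfun_simp -evNl -evDl. Qed.

Lemma RopE (B : vectType k) (op : 'Hom(B, 'End(B))) (x y : B) :
  Rop op x y = op y x.
Proof. exact: flipE. Qed.

Lemma bulletE (B : vectType k) (op op' : 'Hom(B, 'End(B))) (x y : B) :
  bullet op op' x y = op' x y - op x y.
Proof. by rewrite /bullet !lfun_simp. Qed.

Lemma comp_Rop_bullet (op op' : 'Hom(A, 'End(A))) a x :
  (a \o Rop (bullet op op') x = (a \o Rop op' x) - (a \o Rop op x))%VF.
Proof.
rewrite -comp_lfunNr -comp_lfunDr; congr (_ \o _)%VF; apply/lfunP => y.
by rewrite add_lfunE opp_lfunE !RopE bulletE.
Qed.

Lemma comp_Lop_bullet (op op' : 'Hom(A, 'End(A))) a x :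
  (a \o Lop (bullet op op') x = (a \o Lop op' x) - (a \o Lop op x))%VF.
Proof.
rewrite -comp_lfunNr -comp_lfunDr; congr (_ \o _)%VF; apply/lfunP => y.
by rewrite add_lfunE opp_lfunE /Lop bulletE.
Qed.

Lemma ev_comp a (h : 'End(A)) x : ev (a \o h)%VF x = ev a (h x).
Proof. by rewrite /ev comp_lfunE. Qed.

Lemma transp_comp (rho : 'Hom(A, 'End(A))) x a :
  transp rho x a = (a \o rho x)%VF.
Proof. by apply/lfunP => z; rewrite transpE comp_lfunE. Qed.

Lemma transpN_comp (rho : 'Hom(A, 'End(A))) x a :
  (- transp rho) x a = - (a \o rho x)%VF.
Proof. by rewrite !opp_lfunE transp_comp. Qed.

Lemma ev_unbidual_Lop op b x c :
  ev c (unbidual (transp (Lop op)) b x) = ev (op b c) x.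
Proof. exact: unbidualE. Qed.

Lemma ev_unbidual_Rop op b x c :
  ev c (unbidual (transp (Rop op)) b x) = ev (op c b) x.
Proof. by rewrite /ev unbidualE RopE. Qed.

Lemma ev_unbidualN_Rop op b x c :
  ev c ((- unbidual (transp (Rop op))) b x) = - ev (op c b) x.
Proof. by rewrite !opp_lfunE evNr ev_unbidual_Rop. Qed.

Lemma bidual_inj : injective (bidual A).
Proof.
move=> x y E; rewrite (coord_vbasis (memvf x)) (coord_vbasis (memvf y)).
apply: eq_bigr => i _; congr (_ *: _).
pose c : dual A := linfun (coord (vbasis {:A}) i : A -> k^o).
by have := congr1 (fun f : dual (dual A) => f c) E; rewrite !bidualE !lfunE.
Qed.

Definition omega (s t : A * dual A) : k := ev s.2 t.1 - ev t.2 s.1.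

Lemma omega_addr s : {morph omega s : t u / t + u}.
Proof. by move=> [x a] [y b]; rewrite /omega /= evDl evDr opprD addrACA. Qed.

Lemma omega_skew s t : omega s t = - omega t s.
Proof. by rewrite /omega opprB. Qed.

Lemma omega_nondeg s t : (forall w, omega s w = omega t w) -> s = t.
Proof.
case: s t => [x a] [y b] E; congr pair.
  apply: bidual_inj; apply/lfunP => c; rewrite !bidualE.
  by have:= E (0, c); rewrite /omega /ev /= !linear0 !sub0r => /oppr_inj.
apply/lfunP => z; have:= E (z, 0).
by rewrite /omega /ev /= !zero_lfunE !subr0.
Qed.

End Evaluation.

(** * The double of A and its dual, and invariance of the form *)

Section Form.

Variables (k : fieldType) (A : vectType k).
Variables (d v : 'Hom(A, 'End(A))) (ds vs : 'Hom(dual A, 'End(dual A))).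
Implicit Types (x y : A) (a b : dual A).

(** The two operations of the double carry exactly the actions of the tuple in the theorem, so the
    last component of [matched_pair] is diassociativity of [double_d] and [double_v] by
    conversion. *)
Definition double_d :=
  bowtie d ds
    (- transp (Rop (bullet d v))) (transp (Lop v))
    (- unbidual (transp (Rop (bullet ds vs)))) (unbidual (transp (Lop vs))).

Definition double_v :=
  bowtie v vs
    (transp (Rop d)) (transp (Lop (bullet d v)))
    (unbidual (transp (Rop ds))) (unbidual (transp (Lop (bullet ds vs)))).

Lemma double_dE x a y b : double_d (x, a) (y, b) =
  (d x y + unbidual (transp (Lop vs)) b x +
     (- unbidual (transp (Rop (bullet ds vs)))) a y,
   ds a b - (b \o Rop (bullet d v) x)%VF + (a \o Lop v y)%VF).
Proof. by rewrite /double_d bowtieE transpN_comp transp_comp. Qed.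

Lemma double_vE x a y b : double_v (x, a) (y, b) =
  (v x y + unbidual (transp (Lop (bullet ds vs))) b x +
     unbidual (transp (Rop ds)) a y,
   vs a b + (b \o Rop d x)%VF + (a \o Lop (bullet d v) y)%VF).
Proof. by rewrite /double_v bowtieE !transp_comp. Qed.

Lemma omega_dl x a y b z c : omega (double_d (x, a) (y, b)) (z, c) =
  ev (ds a b) z - ev b (bullet d v z x) + ev a (v y z) -
  (ev c (d x y) + ev (vs b c) x - ev (bullet ds vs c a) y).
Proof.
rewrite double_dE /omega /= !evDl evNl !evDr ev_unbidual_Lop ev_unbidualN_Rop.
by rewrite !ev_comp RopE.
Qed.

Lemma omega_vl x a y b z c : omega (double_v (x, a) (y, b)) (z, c) =
  ev (vs a b) z + ev b (d z x) + ev a (bullet d v y z) -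
  (ev c (v x y) + ev (bullet ds vs b c) x + ev (ds c a) y).
Proof.
rewrite double_vE /omega /= !evDl !evDr ev_unbidual_Lop ev_unbidual_Rop.
by rewrite !ev_comp RopE.
Qed.

(** After [omega_skew] on the right, both sides expand to the same six evaluations: the signs and
    transposes in the actions are chosen for this. *)
Lemma omega_double_d s t u : omega (double_d s t) u = omega s (double_v t u).
Proof.
case: s t u => [x a] [y b] [z c].
by rewrite omega_dl [RHS]omega_skew omega_vl; ring.
Qed.

Lemma omega_double_v s t u :
  omega (double_v s t) u = omega s (double_v t u) - omega s (double_d t u).
Proof.
case: s t u => [x a] [y b] [z c].
rewrite omega_vl !(omega_skew (x, a)) omega_vl omega_dl !bulletE.
by rewrite !evDr !evDl !evNr !evNl; ring.
Qed.

(** * Homogeneous products in the double and the two mixed quadruples *)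

Local Notation bs := (bullet ds vs).
Local Notation bA := (bullet d v).

Lemma double_dAB x a : double_d (x, 0) (0, a) =
  (unbidual (transp (Lop vs)) a x, - (a \o Rop bA x)%VF).
Proof.
rewrite /double_d bowtieE !linear0 !zero_lfunE.
by rewrite !(add0r, addr0) transpN_comp.
Qed.

Lemma double_vAB x a : double_v (x, 0) (0, a) =
  (unbidual (transp (Lop bs)) a x, (a \o Rop d x)%VF).
Proof.
rewrite /double_v bowtieE !linear0 !zero_lfunE.
by rewrite !(add0r, addr0) transp_comp.
Qed.

Lemma double_dBA x a : double_d (0, a) (x, 0) =
  ((- unbidual (transp (Rop bs))) a x, (a \o Lop v x)%VF).
Proof.
rewrite /double_d bowtieE !linear0 !zero_lfunE.
by rewrite !(add0r, addr0) transp_comp.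
Qed.

Lemma double_vBA x a : double_v (0, a) (x, 0) =
  (unbidual (transp (Rop ds)) a x, (a \o Lop bA x)%VF).
Proof.
rewrite /double_v bowtieE !linear0 !zero_lfunE.
by rewrite !(add0r, addr0) transp_comp.
Qed.

Lemma double_dAA x y : double_d (x, 0) (y, 0) = (d x y, 0).
Proof.
by rewrite /double_d bowtieE !linear0 !zero_lfunE !(add0r, addr0).
Qed.

Lemma double_vAA x y : double_v (x, 0) (y, 0) = (v x y, 0).
Proof.
by rewrite /double_v bowtieE !linear0 !zero_lfunE !(add0r, addr0).
Qed.

Lemma double_dBB a b : double_d (0, a) (0, b) = (0, ds a b).
Proof.
by rewrite /double_d bowtieE !linear0 !zero_lfunE !(add0r, addr0).
Qed.

Lemma double_vBB a b : double_v (0, a) (0, b) = (0, vs a b).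
Proof.
by rewrite /double_v bowtieE !linear0 !zero_lfunE !(add0r, addr0).
Qed.

(** Builds the arguments of [diass_atE] from a formula for each product and the two evaluations
    rewritten as values of the operations on the dual. *)
Lemma omega_eval (s t : A * dual A) p f q g (r1 r2 : k) :
  s = (p, f) -> t = (q, g) -> ev f q = r1 -> ev g p = r2 -> omega s t = r1 - r2.
Proof. by move=> -> -> <- <-. Qed.

Lemma omega_evalAB (s t : A * dual A) p q :
  s = (p, 0) -> t = (0, q) -> omega s t = - ev q p.
Proof. by move=> -> ->; rewrite /omega /= {1}/ev zero_lfunE sub0r. Qed.

(* (1), (4), (5), (6) paired with a (x) b. *)
Definition eqs_AABB x y a b : Prop :=
  [/\ ev (vs a b) (d x y) =
      ev (vs a (b \o Lop d x)%VF) y - ev (vs (a \o Rop bA y)%VF b) x /\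
      ev (vs a (b \o Lop d x)%VF) y - ev (vs (a \o Rop bA y)%VF b) x =
      ev (bs a (b \o Lop d x)%VF) y + ev (vs (a \o Rop d y)%VF b) x,
      ev (ds a b) (v x y) =
      ev (ds a (b \o Lop v x)%VF) y - ev (bs (a \o Rop v y)%VF b) x /\
      ev (ds a (b \o Lop v x)%VF) y - ev (bs (a \o Rop v y)%VF b) x =
      ev (ds a (b \o Lop bA x)%VF) y + ev (ds (a \o Rop v y)%VF b) x,
      ev (ds a b) (d x y) =
      ev (ds (a \o Rop d y)%VF b) x - ev (bs a (b \o Lop bA x)%VF) y &
      ev (vs a b) (v x y) =
      ev (vs a (b \o Lop v x)%VF) y - ev (bs (a \o Rop bA y)%VF b) x].

(* (2), (3) paired with b (x) a. *)
Definition eqs_ABAB x y a b : Prop :=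
  (ev (vs (a \o Lop v y)%VF b) x - ev (bs (b \o Lop d x)%VF a) y =
   ev (ds (b \o Lop d x)%VF a) y + ev (vs (a \o Lop bA y)%VF b) x /\
   ev (ds (b \o Lop d x)%VF a) y + ev (vs (a \o Lop bA y)%VF b) x =
   ev (vs a (b \o Rop d y)%VF) x + ev (bs b (a \o Rop bA x)%VF) y) /\
  (ev (vs a (b \o Rop v y)%VF) x - ev (ds b (a \o Rop bA x)%VF) y =
   ev (ds b (a \o Rop d x)%VF) y + ev (bs a (b \o Rop v y)%VF) x /\
   ev (ds b (a \o Rop d x)%VF) y + ev (bs a (b \o Rop v y)%VF) x =
   ev (ds (b \o Lop v x)%VF a) y + ev (bs (a \o Lop bA y)%VF b) x).

Local Notation at_double := (diass_at double_d double_v (@omega k A)).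
Local Notation evL := (ev_unbidual_Lop _ _ _ _).
Local Notation evR := (ev_unbidual_Rop _ _ _ _).
Local Notation evNR := (ev_unbidualN_Rop _ _ _ _).

Ltac expand := rewrite ?comp_Rop_bullet ?comp_Lop_bullet ?ev_bullet
  ?ev_opBr ?ev_opBl.

(** Both sides are linear systems in the same twelve evaluations, and the systems are equivalent for
    each fixed quadruple. *)
Lemma diass_at_AABB x y a b :
  at_double (x, 0) (y, 0) (0, a) (0, b) <-> eqs_AABB x y a b.
Proof.
apply: (iff_trans (diass_atE (@omega_skew _ _) omega_double_d omega_double_v
  (omega_evalAB (double_dAA x y) (double_dBB a b))
  (omega_evalAB (double_dAA x y) (double_vBB a b))
  (omega_evalAB (double_vAA x y) (double_dBB a b))
  (omega_evalAB (double_vAA x y) (double_vBB a b))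
  (omega_eval (double_dAB y a) (double_dBA x b) evNR evL)
  (omega_eval (double_dAB y a) (double_vBA x b) evR evL)
  (omega_eval (double_vAB y a) (double_dBA x b) evNR evL)
  (omega_eval (double_vAB y a) (double_vBA x b) evR evL))).
rewrite /eqs_AABB; expand; rewrite ?ev_opNl ?ev_opNr; expand.
(* The twelve evaluations become free scalars, so only linear algebra remains. The second halves of
   (1) and (4) cancel down to one and the same equation, which is [h1b]. *)
move: (ev (vs a b) (d x y)) (ev (vs a b) (v x y))
  (ev (ds a b) (d x y)) (ev (ds a b) (v x y)).
move: (ev (vs (a \o Rop v y)%VF b) x) (ev (vs (a \o Rop d y)%VF b) x)
  (ev (ds (a \o Rop v y)%VF b) x) (ev (ds (a \o Rop d y)%VF b) x).
move: (ev (vs a (b \o Lop v x)%VF) y) (ev (vs a (b \o Lop d x)%VF) y)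
  (ev (ds a (b \o Lop v x)%VF) y) (ev (ds a (b \o Lop d x)%VF) y).
move=> q1 q2 q3 q4 q5 q6 q7 q8 p1 p2 p3 p4.
split=> [[[h1 h1b] h2 [h3 h4]]|[[E1 E1b] [E4 E4b] E5 E6]].
  split; [split | split | | ].
  - by apply: (eq_of_subr_eq (esym h1)); ring.
  - by apply: (eq_of_subr_eq (esym h1b)); ring.
  - by apply: (eq_of_subr_eq (eq_add (eq_add h3 h4) (esym h2))); ring.
  - by apply: (eq_of_subr_eq (esym h1b)); ring.
  - by apply: (eq_of_subr_eq (eq_add (eq_add h4 (esym h1)) (esym h1b))); ring.
  - by apply: (eq_of_subr_eq (esym h2)); ring.
split; [split | | split].
- by apply: (eq_of_subr_eq (esym E1)); ring.
- by apply: (eq_of_subr_eq (esym E1b)); ring.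
- by apply: (eq_of_subr_eq (esym E6)); ring.
- have E := eq_add (eq_add E4 E1) (eq_add E1b (esym (eq_add E5 E6))).
  by apply: (eq_of_subr_eq E); ring.
- by apply: (eq_of_subr_eq (eq_add (eq_add E5 (esym E1)) (esym E1b))); ring.
Qed.

(** Rotating twice exchanges [(x, a)] with [(y, b)]. The left side is therefore symmetric under this
    exchange, and it yields (2) and (3) in both orders. *)
Lemma diass_at_ABAB x y a b :
  at_double (x, 0) (0, a) (y, 0) (0, b) <->
  eqs_ABAB x y a b /\ eqs_ABAB y x b a.
Proof.
apply: (iff_trans (diass_atE (@omega_skew _ _) omega_double_d omega_double_v
  (omega_eval (double_dAB x a) (double_dAB y b) evL evL)
  (omega_eval (double_dAB x a) (double_vAB y b) evL evL)
  (omega_eval (double_vAB x a) (double_dAB y b) evL evL)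
  (omega_eval (double_vAB x a) (double_vAB y b) evL evL)
  (omega_eval (double_dBA y a) (double_dBA x b) evNR evNR)
  (omega_eval (double_dBA y a) (double_vBA x b) evR evNR)
  (omega_eval (double_vBA y a) (double_dBA x b) evNR evR)
  (omega_eval (double_vBA y a) (double_vBA x b) evR evR))).
rewrite /eqs_ABAB; expand; rewrite ?ev_opNl ?ev_opNr; expand.
move: (ev (vs (a \o Lop v y)%VF b) x) (ev (vs (a \o Lop d y)%VF b) x)
  (ev (ds (a \o Lop v y)%VF b) x) (ev (ds (a \o Lop d y)%VF b) x).
move: (ev (vs (b \o Lop v x)%VF a) y) (ev (vs (b \o Lop d x)%VF a) y)
  (ev (ds (b \o Lop v x)%VF a) y) (ev (ds (b \o Lop d x)%VF a) y).
move: (ev (vs b (a \o Rop v x)%VF) y) (ev (vs b (a \o Rop d x)%VF) y)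
  (ev (ds b (a \o Rop v x)%VF) y) (ev (ds b (a \o Rop d x)%VF) y).
move: (ev (vs a (b \o Rop v y)%VF) x) (ev (vs a (b \o Rop d y)%VF) x)
  (ev (ds a (b \o Rop v y)%VF) x) (ev (ds a (b \o Rop d y)%VF) x).
move=> r1 r2 r3 r4 s1 s2 s3 s4 t1 t2 t3 t4 u1 u2 u3 u4.
(* [F1], [F2] are the halves of (2), [G1], [G2] those of (3), and [G2'] is the second half of (3)
   after the exchange. *)
split=> [[[h1 h1b] h2 [h3 h4]]|[[[F1 F2] [G1 G2]] [_ [_ G2']]]].
  split; (split; split).
  - by apply: (eq_of_subr_eq (esym h1b)); ring.
  - by apply: (eq_of_subr_eq (eq_add h1 h1b)); ring.
  - by apply: (eq_of_subr_eq h3); ring.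
  - by apply: (eq_of_subr_eq (esym (eq_add h4 h3))); ring.
  - by apply: (eq_of_subr_eq h1b); ring.
  - have E := eq_add (eq_add h3 h4) (esym (eq_add h2 h1b)).
    by apply: (eq_of_subr_eq E); ring.
  - by apply: (eq_of_subr_eq (esym h3)); ring.
  - by apply: (eq_of_subr_eq (eq_add h2 (esym h1))); ring.
split; [split | | split].
- by apply: (eq_of_subr_eq (eq_add F1 F2)); ring.
- by apply: (eq_of_subr_eq (esym F1)); ring.
- by apply: (eq_of_subr_eq (eq_add (eq_add F1 F2) G2')); ring.
- by apply: (eq_of_subr_eq G1); ring.
- by apply: (eq_of_subr_eq (esym (eq_add G1 G2))); ring.
Qed.

End Form.

(** * Coproducts as linear duals, read through their pairings *)

Section LinearDual.

Variables (k : fieldType) (A : vectType k).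
Implicit Types (op : 'Hom(dual A, 'End(dual A))) (D : 'Hom(A, tensor A A)).
Implicit Types (x : A) (a b c : dual A) (h : 'End(A)).

Lemma linear_dual_bullet op op' D D' :
  linear_dual op D -> linear_dual op' D' ->
  linear_dual (bullet op op') (D' - D).
Proof.
move=> opD opD' x a b.
by rewrite add_lfunE opp_lfunE linearB /= opD opD' /bullet !lfun_simp.
Qed.

Lemma linear_dual_pair op D : linear_dual op D ->
  forall a b, (tpair a b \o D)%VF = op a b.
Proof. by move=> opD a b; apply/lfunP => x; rewrite comp_lfunE opD. Qed.

(** Records the bilinear form that a tensor defines. The lemmas on [pairs_to] follow the shape of
    the bialgebra identities, so the form of each side is assembled by unification and [pairs_to_eq]
    does the translation. *)
Definition pairs_to (t : tensor A A) (phi : dual A -> dual A -> k) :=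
  forall a b, ev (tpair a b) t = phi a b.

Lemma pairs_to_eq s t phi psi : pairs_to s phi -> pairs_to t psi ->
  s = t <-> forall a b, phi a b = psi a b.
Proof.
move=> s_phi t_psi; split=> [st a b | E]; first by rewrite -s_phi -t_psi st.
by apply: tensor_pair_eq => a b; have := E a b; rewrite -s_phi -t_psi.
Qed.

Lemma pairs_toD s t phi psi : pairs_to s phi -> pairs_to t psi ->
  pairs_to (s + t) (fun a b => phi a b + psi a b).
Proof. by move=> s_phi t_psi a b; rewrite evDr s_phi t_psi. Qed.

Lemma pairs_toB s t phi psi : pairs_to s phi -> pairs_to t psi ->
  pairs_to (s - t) (fun a b => phi a b - psi a b).
Proof. by move=> s_phi t_psi a b; rewrite evDr evNr s_phi t_psi. Qed.

Lemma pairs_to_tswap t phi :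
  pairs_to t phi -> pairs_to (tswap t) (fun a b => phi b a).
Proof. by move=> t_phi a b; rewrite -t_phi /ev tpair_tswap. Qed.

Lemma pairs_to_dual op D x : linear_dual op D ->
  pairs_to (D x) (fun a b => ev (op a b) x).
Proof. by move=> opD a b; apply: opD. Qed.

Lemma pairs_to_oxl op D h x : linear_dual op D ->
  pairs_to ((h \ox \1%VF) (D x)) (fun a b => ev (op (a \o h)%VF b) x).
Proof. by move=> opD a b; rewrite /ev tpair_tmap comp_lfun1r opD. Qed.

Lemma pairs_to_oxr op D h x : linear_dual op D ->
  pairs_to ((\1%VF \ox h) (D x)) (fun a b => ev (op a (b \o h)%VF) x).
Proof. by move=> opD a b; rewrite /ev tpair_tmap comp_lfun1r opD. Qed.

Lemma tpair3_oxr op D op' D' : linear_dual op D -> linear_dual op' D' ->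
  forall a b c x,
  tpair a (tpair b c) (((\1%VF \ox D') \o D)%VF x) = op a (op' b c) x.
Proof.
move=> opD opD' a b c x.
by rewrite comp_lfunE tpair_tmap comp_lfun1r (linear_dual_pair opD') opD.
Qed.

Lemma tpair3_oxl op D op' D' : linear_dual op D -> linear_dual op' D' ->
  forall a b c x,
  tpair a (tpair b c) ((tassoc \o (D' \ox \1%VF) \o D)%VF x) = op (op' a b) c x.
Proof.
move=> opD opD' a b c x; rewrite !comp_lfunE tpair_tassoc tpair_tmap.
by rewrite comp_lfun1r (linear_dual_pair opD') opD.
Qed.

(** Paired with three functionals, each coalgebra axiom becomes an axiom of the dual algebra
    evaluated at [x]. *)
Lemma linear_dual_coalgebra (ds vs : 'Hom(dual A, 'End(dual A)))
    (Dd Dv : 'Hom(A, tensor A A)) :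
  linear_dual ds Dd -> linear_dual vs Dv ->
  diassociative_algebra ds vs -> diassociative_coalgebra Dd Dv.
Proof.
move=> dD vD [dd vd vv].
have dl := tpair3_oxl dD; have dr := tpair3_oxr dD.
have vl := tpair3_oxl vD; have vr := tpair3_oxr vD.
split; [split | | split]; apply/lfunP => x; apply: tensor3_pair_eq => a b c.
- by rewrite (dr _ _ dD) (dr _ _ vD) (proj2 (dd a b c)).
- by rewrite (dr _ _ vD) (dl _ _ dD) -(proj2 (dd a b c)) (proj1 (dd a b c)).
- by rewrite (dl _ _ vD) (vr _ _ dD) vd.
- by rewrite (vl _ _ dD) (vl _ _ vD) (proj1 (vv a b c)).
- by rewrite (vl _ _ vD) (vr _ _ vD) (proj1 (vv a b c)) (proj2 (vv a b c)).
Qed.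

End LinearDual.

(** * The bialgebra identities in paired form *)

Section Bialgebra.

Variables (k : fieldType) (A : vectType k).
Variables (d v : 'Hom(A, 'End(A))) (ds vs : 'Hom(dual A, 'End(dual A))).
Variables (Dd Dv : 'Hom(A, tensor A A)).
Hypotheses (Dd_dual : linear_dual ds Dd) (Dv_dual : linear_dual vs Dv).

Let Db_dual := linear_dual_bullet Dd_dual Dv_dual.

Lemma bialgebra_eqsP :
  diassociative_algebra d v -> diassociative_algebra ds vs ->
  diassociative_bialgebra d v Dd Dv <->
  (forall x y a b, eqs_AABB d v ds vs x y a b) /\
  (forall x y a b, eqs_ABAB d v ds vs x y a b).
Proof.
move=> dA dAs.
(* The letters D, V, B stand for the coproducts of dashv, vdash and their bullet; [l] and [r] tell
   the tensor factor on which [h] acts. *)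
pose D1 x := pairs_to_dual x Dd_dual.
pose V1 x := pairs_to_dual x Dv_dual.
pose Dl h x := pairs_to_oxl h x Dd_dual.
pose Dr h x := pairs_to_oxr h x Dd_dual.
pose Vl h x := pairs_to_oxl h x Dv_dual.
pose Vr h x := pairs_to_oxr h x Dv_dual.
pose Bl h x := pairs_to_oxl h x Db_dual.
pose Br h x := pairs_to_oxr h x Db_dual.
pose b := bullet d v.
have e1a x y := pairs_to_eq (V1 (d x y))
  (pairs_toB (Vr (Lop d x) y) (Vl (Rop b y) x)).
have e1b x y := pairs_to_eq (pairs_toB (Vr (Lop d x) y) (Vl (Rop b y) x))
  (pairs_toD (Br (Lop d x) y) (Vl (Rop d y) x)).
have e2a x y := pairs_to_eq
  (pairs_toB (pairs_to_tswap (Vl (Lop v y) x)) (Bl (Lop d x) y))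
  (pairs_toD (Dl (Lop d x) y) (pairs_to_tswap (Vl (Lop b y) x))).
have e2b x y := pairs_to_eq
  (pairs_toD (Dl (Lop d x) y) (pairs_to_tswap (Vl (Lop b y) x)))
  (pairs_toD (pairs_to_tswap (Vr (Rop d y) x)) (Br (Rop b x) y)).
have e3a x y := pairs_to_eq
  (pairs_toB (pairs_to_tswap (Vr (Rop v y) x)) (Dr (Rop b x) y))
  (pairs_toD (Dr (Rop d x) y) (pairs_to_tswap (Br (Rop v y) x))).
have e3b x y := pairs_to_eq
  (pairs_toD (Dr (Rop d x) y) (pairs_to_tswap (Br (Rop v y) x)))
  (pairs_toD (Dl (Lop v x) y) (pairs_to_tswap (Bl (Lop b y) x))).
have e4a x y := pairs_to_eq (D1 (v x y))
  (pairs_toB (Dr (Lop v x) y) (Bl (Rop v y) x)).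
have e4b x y := pairs_to_eq (pairs_toB (Dr (Lop v x) y) (Bl (Rop v y) x))
  (pairs_toD (Dr (Lop b x) y) (Dl (Rop v y) x)).
have e5 x y := pairs_to_eq (D1 (d x y))
  (pairs_toB (Dl (Rop d y) x) (Br (Lop b x) y)).
have e6 x y := pairs_to_eq (V1 (v x y))
  (pairs_toB (Vr (Lop v x) y) (Bl (Rop b y) x)).
split=> [[_ _ h1 h2 h3 h4 h5 h6] | [AABB ABAB]].
  split=> x y f g; have [h1a h1b] := h1 x y; have [h4a h4b] := h4 x y;
    have [h2a h2b] := h2 x y; have [h3a h3b] := h3 x y.
    split; [split | split | | ].
    + exact: (e1a x y).1.
    + exact: (e1b x y).1.
    + exact: (e4a x y).1.
    + exact: (e4b x y).1.
    + exact: (e5 x y).1.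
    + exact: (e6 x y).1.
  (* The functionals are swapped here because [eqs_ABAB] pairs with its last argument first. *)
  split; split.
  + exact: ((e2a x y).1 h2a g f).
  + exact: ((e2b x y).1 h2b g f).
  + exact: ((e3a x y).1 h3a g f).
  + exact: ((e3b x y).1 h3b g f).
split=> //; first exact: linear_dual_coalgebra dAs.
- move=> x y; split; [apply: (e1a x y).2 | apply: (e1b x y).2] => f g.
    by have [[]] := AABB x y f g.
  by have [[]] := AABB x y f g.
- move=> x y; split; [apply: (e2a x y).2 | apply: (e2b x y).2] => f g.
    by have [[]] := ABAB x y g f.
  by have [[]] := ABAB x y g f.
- move=> x y; split; [apply: (e3a x y).2 | apply: (e3b x y).2] => f g.
    by have [_ []] := ABAB x y g f.
  by have [_ []] := ABAB x y g f.
- move=> x y; split; [apply: (e4a x y).2 | apply: (e4b x y).2] => f g.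
    by have [_ []] := AABB x y f g.
  by have [_ []] := AABB x y f g.
- by move=> x y; apply: (e5 x y).2 => f g; have [] := AABB x y f g.
- by move=> x y; apply: (e6 x y).2 => f g; have [] := AABB x y f g.
Qed.

End Bialgebra.

(** * Diassociativity of the double from the mixed quadruples *)

Section Double.

Variables (k : fieldType) (A : vectType k).
Variables (d v : 'Hom(A, 'End(A))) (ds vs : 'Hom(dual A, 'End(dual A))).
Local Notation D := (double_d d v ds vs).
Local Notation V := (double_v d v ds vs).
Local Notation at_double := (diass_at D V (@omega k A)).

(** Nondegeneracy of [omega] removes the test vector [w]. *)
Lemma double_diassP : diassociative_algebra D V <->
  forall s t u w, at_double s t u w.
Proof.
split=> [[dd vd vv] s t u w | E].
  split; [split | | split]; apply: (congr1 (fun r => omega r w)).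
  - exact: (dd s t u).1.
  - exact: (dd s t u).2.
  - exact: vd.
  - exact: (vv s t u).1.
  - exact: (vv s t u).2.
split=> s t u.
- split; apply: omega_nondeg => w.
    by have [[E1 _] _ _] := E s t u w.
  by have [[_ E1] _ _] := E s t u w.
- by apply: omega_nondeg => w; have [_ E1 _] := E s t u w.
- split; apply: omega_nondeg => w.
    by have [_ _ [E1 _]] := E s t u w.
  by have [_ _ [_ E1]] := E s t u w.
Qed.

Hypotheses (dA : diassociative_algebra d v) (dAs : diassociative_algebra ds vs).

Let mulL (P Q : 'Hom((A * dual A)%type, 'End((A * dual A)%type))) s t u p r :
  P s t = p -> Q p u = r -> Q (P s t) u = r.
Proof. by move=> ->. Qed.

Let mulR (P Q : 'Hom((A * dual A)%type, 'End((A * dual A)%type))) s t u p r :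
  P t u = p -> Q s p = r -> Q s (P t u) = r.
Proof. by move=> ->. Qed.

Lemma double_AAA (x y z : A) w : at_double (x, 0) (y, 0) (z, 0) w.
Proof.
have [dd vd vv] := dA.
have D2 := @double_dAA k A d v ds vs; have V2 := @double_vAA k A d v ds vs.
have DD := mulL (D2 x y) (D2 _ z); have DV := mulL (V2 x y) (D2 _ z).
have VD := mulL (D2 x y) (V2 _ z); have VV := mulL (V2 x y) (V2 _ z).
have DD' := mulR (D2 y z) (D2 x _); have DV' := mulR (V2 y z) (D2 x _).
have VD' := mulR (D2 y z) (V2 x _); have VV' := mulR (V2 y z) (V2 x _).
split; [split | | split]; apply: (congr1 (fun r => omega r w)).
- by rewrite DD DD' (dd x y z).1.
- by rewrite DD' DV' (dd x y z).2.
- by rewrite DV VD' vd.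
- by rewrite VV VD (vv x y z).1.
- by rewrite VD VV' (vv x y z).2.
Qed.

Lemma double_BBB (a b c : dual A) w : at_double (0, a) (0, b) (0, c) w.
Proof.
have [dd vd vv] := dAs.
have D2 := @double_dBB k A d v ds vs; have V2 := @double_vBB k A d v ds vs.
have DD := mulL (D2 a b) (D2 _ c); have DV := mulL (V2 a b) (D2 _ c).
have VD := mulL (D2 a b) (V2 _ c); have VV := mulL (V2 a b) (V2 _ c).
have DD' := mulR (D2 b c) (D2 a _); have DV' := mulR (V2 b c) (D2 a _).
have VD' := mulR (D2 b c) (V2 a _); have VV' := mulR (V2 b c) (V2 a _).
split; [split | | split]; apply: (congr1 (fun r => omega r w)).
- by rewrite DD DD' (dd a b c).1.
- by rewrite DD' DV' (dd a b c).2.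
- by rewrite DV VD' vd.
- by rewrite VV VD (vv a b c).1.
- by rewrite VD VV' (vv a b c).2.
Qed.

(** Additivity is available in the last slot only ([diass_atD]); rotation brings every other slot
    there, and also reduces the homogeneous quadruples to a few patterns. *)
Lemma double_at :
  (forall x y a b, at_double (x, 0) (y, 0) (0, a) (0, b)) ->
  (forall x y a b, at_double (x, 0) (0, a) (y, 0) (0, b)) ->
  forall s t u w, at_double s t u w.
Proof.
move=> AABB ABAB.
have rot s t u w : at_double t u w s -> at_double s t u w.
  by apply: diass_at_rot;
    [exact: omega_skew | exact: omega_double_d | exact: omega_double_v].
have rot2 s t u w : at_double u w s t -> at_double s t u w.
  by move=> /rot /rot.
have rot3 s t u w : at_double w s t u -> at_double s t u w.
  by move=> /rot /rot /rot.
pose e (z : A + dual A) : A * dual A :=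
  match z with inl x => (x, 0) | inr a => (0, a) end.
have homog z1 z2 z3 z4 : at_double (e z1) (e z2) (e z3) (e z4).
  (* Of the sixteen patterns, ten have at least three entries on one side, four are rotations of
     AABB and two are rotations of ABAB. *)
  case: z1 z2 z3 z4 => [x1|a1] [x2|a2] [x3|a3] [x4|a4] /=.
  - exact: double_AAA.
  - exact: double_AAA.
  - apply: (rot3); exact: double_AAA.
  - exact: AABB.
  - apply: (rot2); exact: double_AAA.
  - exact: ABAB.
  - apply: (rot3); exact: AABB.
  - apply: (rot); exact: double_BBB.
  - apply: (rot); exact: double_AAA.
  - apply: (rot); exact: AABB.
  - apply: (rot); exact: ABAB.
  - apply: (rot2); exact: double_BBB.
  - apply: (rot2); exact: AABB.
  - apply: (rot3); exact: double_BBB.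
  - exact: double_BBB.
  - exact: double_BBB.
have any4 s t u :
    (forall z, at_double s t u (e z)) -> forall w, at_double s t u w.
  move=> E [x a]; have -> : (x, a) = e (inl x) + e (inr a).
    by congr pair; rewrite /= ?addr0 ?add0r.
  by apply: diass_atD; [exact: omega_addr | exact: E | exact: E].
(* The slots are freed from homogeneity one after another, each being rotated to the last place,
   split by [any4] and rotated back. *)
have any34 z1 z2 u w : at_double (e z1) (e z2) u w.
  apply: (rot3); apply: (any4) => z3; apply: (rot); exact: (any4).
have any234 z1 t u w : at_double (e z1) t u w.
  apply: (rot2); apply: (any4) => z2; apply: (rot2); exact: any34.
move=> s t u w; apply: (rot); apply: (any4) => z1; apply: (rot3); exact: any234.
Qed.

End Double.

Unset Implicit Arguments.

Theorem theorem3p6 (k : fieldType) (k_char0 : [pchar k] =i pred0)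
    (A : vectType k)
    (d v : 'Hom(A, 'End(A))) (ds vs : 'Hom(dual A, 'End(dual A)))
    (Dd Dv : 'Hom(A, tensor A A))
    (diassA : diassociative_algebra d v)
    (diassAs : diassociative_algebra ds vs)
    (Dd_dual : linear_dual ds Dd) (Dv_dual : linear_dual vs Dv) :
  matched_pair d v ds vs
    (- transp (Rop (bullet d v))) (transp (Lop v))
    (transp (Rop d)) (transp (Lop (bullet d v)))
    (- unbidual (transp (Rop (bullet ds vs)))) (unbidual (transp (Lop vs)))
    (unbidual (transp (Rop ds))) (unbidual (transp (Lop (bullet ds vs))))
  <-> diassociative_bialgebra d v Dd Dv.
Proof.
apply: iff_trans (iff_sym (bialgebra_eqsP Dd_dual Dv_dual diassA diassAs)).
split=> [[_ _ /double_diassP E] | [AABB ABAB]].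
  split=> x y a b; first exact: (diass_at_AABB d v ds vs x y a b).1.
  exact: ((diass_at_ABAB d v ds vs x y a b).1 (E _ _ _ _)).1.
split; [exact: diassA | exact: diassAs | apply/double_diassP].
apply: (double_at diassA diassAs) => x y a b.
  exact: (diass_at_AABB d v ds vs x y a b).2 (AABB x y a b).
(* [ABAB] holds for all arguments, hence also for the exchanged pairs that the equivalence asks
   for. *)
by apply: (diass_at_ABAB d v ds vs x y a b).2; split; apply: ABAB.
Qed.
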